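(* Let $G$ be a finite acyclic directed graph and $g\in G$. If $g$ is a minimal element of $G$, then - $(\mathcal D,\mathcal U)\mapsto(\mathcal D\cup\{g\},\mathcal U\setminus\{g\})$ is a bijection $\mathrm{top}_g(G)\simeq\mathrm{top}^g(\mathrm{tog}_g(G))$, and - $(\mathcal D,\mathcal U)\mapsto(\mathcal D\setminus\{g\},\mathcal U')$ is a bijection $\mathrm{top}^g(G)\simeq\mathrm{top}_g(\mathrm{tog}_g(G))$, where $\mathcal U'$ is the unique set making $(\mathcal D\setminus\{g\},\mathcal U')$ a top of $\mathrm{tog}_g(G)$. If $g$ is a maximal element of $G$, then - $(\mathcal D,\mathcal U)\mapsto(\mathcal D',\mathcal U\setminus\{g\})$ is a bijection $\mathrm{top}_g(G)\simeq\mathrm{top}^g(\mathrm{tog}_g(G))$, where $\mathcal D'$ is the unique set making $(\mathcal D',\mathcal U\setminus\{g\})$ a top of $\mathrm{tog}_g(G)$, and - $(\mathcal D,\mathcal U)\mapsto(\mathcal D\setminus\{g\},\mathcal U\cup\{g\})$ is a bijection $\mathrm{top}^g(G)\simeq\mathrm{top}_g(\mathrm{tog}_g(G))$. Here $\simeq$ denotes isomorphism of posets.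
   Context: All directed graphs are finite, acyclic (no directed cycles, hence no loops) and without multiple edges; $g\in G$ means $g$ is a vertex of $G$, and $g\to h$ denotes an edge from $g$ to $h$. The $G$-order is the partial order on vertices with $g_1\ge g_2$ iff there is a directed path (possibly of length $0$) from $g_1$ to $g_2$; minimal and maximal elements of $G$ are with respect to $G$-order. An independent set is a set of pairwise non-adjacent vertices. A pair $(\mathcal D,\mathcal U)$ of disjoint independent sets is orthogonal if there is no edge from an element of $\mathcal D$ to an element of $\mathcal U$. An orthogonal pair of independent sets is tight if none of the following operations results in an orthogonal pair of independent sets: removing some $d\in\mathcal D$ and inserting in $\mathcal D$ an element $d'\notin\mathcal D$ with $d'>d$; removing some $u\in\mathcal U$ and inserting in $\mathcal U$ an element $u'\notin\mathcal U$ with $u'<u$; adding a new element to $\mathcal D$; adding a new element to $\mathcal U$. A tight orthogonal pair is called a top, and $\mathrm{top}(G)$ is the set of tops of $G$. For every independent set $\mathcal I$ there is a unique top of the form $(\mathcal I,\mathcal U)$ and a unique top of the form $(\mathcal D,\mathcal I)$. A linear extension $\ell$ of $G$-order is a total order on the vertices such that if $g_1\to g_2$ is an edge then $g_2$ precedes $g_1$; a reverse linear extension $\ell'$ is a total order in which $g_1$ precedes $g_2$ whenever $g_1\to g_2$. Flips: for $(\mathcal D,\mathcal U)\in\mathrm{top}(G)$ and $g\in G$, define $\mathrm{flip}_g(\mathcal D,\mathcal U)=(\mathcal D,\mathcal U)$ if $g\notin\mathcal D\cup\mathcal U$. Otherwise start with $\mathcal D'=\{k\in\mathcal D: k\not\le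 g\}$ and $\mathcal U'=\{k\in\mathcal U:k\not\ge g\}$; add $g$ to $\mathcal D'$ if $g\in\mathcal U$, and add $g$ to $\mathcal U'$ if $g\in\mathcal D$. Then, for $k\not\ge g$ in the order of a reverse linear extension $\ell'$, add $k$ to $\mathcal D'$ if $k\notin\mathcal U'$, there is no edge from $k$ to $\mathcal U'$, and there is no edge from the current $\mathcal D'$ to $k$. Then, for $k\not\le g$ in the order of a linear extension $\ell$, add $k$ to $\mathcal U'$ if $k\notin\mathcal D'$, there is no edge from $\mathcal D'$ to $k$, and there is no edge from $k$ to the current $\mathcal U'$. The result $(\mathcal D',\mathcal U')$ is $\mathrm{flip}_g(\mathcal D,\mathcal U)$; it is a top and does not depend on the choice of $\ell,\ell'$. The independence poset, also denoted $\mathrm{top}(G)$, is the set $\mathrm{top}(G)$ with the reflexive and transitive closure of the relations $(\mathcal D,\mathcal U)<\mathrm{flip}_g(\mathcal D,\mathcal U)$ for $g\in\mathcal U$ (this is a partial order). Its minimum $\hat0$ is the unique top of the form $(\emptyset,\mathcal U)$ and its maximum $\hat1$ is the unique top of the form $(\mathcal D,\emptyset)$. For $g\in G$, let $m_g$ be the unique top of the form $(\mathcal D,\{g\})$ and $j_g$ the unique top of the form $(\{g\},\mathcal U)$; write $\mathrm{top}_g(G)=[\hat0,m_g]$ and $\mathrm{top}^g(G)=[j_g,\hat1]$ (intervals in $\mathrm{top}(G)$). For $g$ minimal or maximal in $G$, $\mathrm{tog}_g(G)$ is the acyclic directed graph obtained from $G$ by reversing all edges incident to $g$.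
   Formalization: Since a top with a given component need not be unique under the stated definition of tight, U' (resp. D') is taken as the unique set putting the image pair in the target interval top_g(tog_g(G)) (resp. top^g(tog_g(G))), rather than the unique set making it a top. *)

(* Defs.v *)
From HB Require Import structures.
From mathcomp Require Import all_boot.

Set Implicit Arguments.
Unset Strict Implicit.
Unset Printing Implicit Defensive.

(* A directed graph without multiple edges on the finite vertex set V is a    *)
(* relation e : rel V, where e g h means that there is an edge g -> h. As     *)
(* connect is the reflexive transitive closure, connect e g h reads g >= h    *)
(* in G-order.                                                                *)

Section Digraph.

Variables (V : finType) (e : rel V).

(* The one-vertex cycle [:: g] is a loop at g, so loops are excluded too. *)
Definition acyclic : Prop := forall p : seq V, p != [::] -> ~~ cycle e p.

Definition minimal_vertex (g : V) : Prop := forall h, connect e g h -> h = g.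
Definition maximal_vertex (g : V) : Prop := forall h, connect e h g -> h = g.

(* A total order on the vertices is given as the list of all the vertices,    *)
(* each occurring once, from first to last.                                   *)
Definition linear_extension (l : seq V) : Prop :=
  perm_eq l (enum V) /\ forall g1 g2, e g1 g2 -> index g2 l < index g1 l.
Definition reverse_linear_extension (l : seq V) : Prop :=
  perm_eq l (enum V) /\ forall g1 g2, e g1 g2 -> index g1 l < index g2 l.

Definition independent (I : {set V}) : bool :=
  [forall x in I, forall y in I, ~~ e x y].

Definition orthogonal (D U : {set V}) : bool :=
  [&& [disjoint D & U], independent D, independent U
    & [forall d in D, forall u in U, ~~ e d u]].

Definition tight (D U : {set V}) : bool :=
  [&& [forall d in D, forall d',
         (d' \notin D) && (d' != d) && connect e d' d ==>
           ~~ orthogonal (d' |: (D :\ d)) U],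
      [forall u in U, forall u',
         (u' \notin U) && (u' != u) && connect e u u' ==>
           ~~ orthogonal D (u' |: (U :\ u))],
      [forall d, (d \notin D) ==> ~~ orthogonal (d |: D) U]
    & [forall u, (u \notin U) ==> ~~ orthogonal D (u |: U)]].

Definition is_top (x : {set V} * {set V}) : bool :=
  orthogonal x.1 x.2 && tight x.1 x.2.

(* The top with a prescribed first or second component. It exists and is      *)
(* unique when I is empty or a singleton, the only cases used below. For      *)
(* larger independent sets it need not be unique: if h1, h2 -> k -> d1, d2    *)
(* are all the edges, then both ({d1, d2}, {k}) and ({d1, d2}, {h1, h2}) are  *)
(* tight.                                                                     *)
Definition top_with_D (I : {set V}) : {set V} * {set V} :=
  odflt (I, set0) [pick x | is_top x & x.1 == I].
Definition top_with_U (I : {set V}) : {set V} * {set V} :=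
  odflt (set0, I) [pick x | is_top x & x.2 == I].

(* [l] is a linear extension and [r] a reverse linear extension of G-order;   *)
(* the flip of a top does not depend on them.                                 *)
Variables (l r : seq V).

Definition flip (g : V) (x : {set V} * {set V}) : {set V} * {set V} :=
  let: (D, U) := x in
  if g \notin D :|: U then x else
  let D0 := [set k in D | ~~ connect e g k] in
  let U0 := [set k in U | ~~ connect e k g] in
  let D1 := if g \in U then g |: D0 else D0 in
  let U1 := if g \in D then g |: U0 else U0 in
  let addD (D' : {set V}) k :=
    if [&& ~~ connect e k g, k \notin U1, [forall u in U1, ~~ e k u]
         & [forall d in D', ~~ e d k]]
    then k |: D' else D' in
  let D2 := foldl addD D1 r in
  let addU (U' : {set V}) k :=
    if [&& ~~ connect e g k, k \notin D2, [forall d in D2, ~~ e d k]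
         & [forall u in U', ~~ e k u]]
    then k |: U' else U' in
  let U2 := foldl addU U1 l in
  (D2, U2).

Definition flip_step : rel ({set V} * {set V}) := fun x y =>
  [&& is_top x, is_top y & [exists g in x.2, y == flip g x]].

Definition top_le : rel ({set V} * {set V}) := connect flip_step.

Definition top_itv (a b : {set V} * {set V}) : {set {set V} * {set V}} :=
  [set x | [&& is_top x, top_le a x & top_le x b]].

(* top_g(G) = [0, m_g] and top^g(G) = [j_g, 1] *)
Definition top_below (g : V) : {set {set V} * {set V}} :=
  top_itv (top_with_D set0) (top_with_U [set g]).
Definition top_above (g : V) : {set {set V} * {set V}} :=
  top_itv (top_with_D [set g]) (top_with_U set0).

End Digraph.

Definition tog (V : finType) (g : V) (e : rel V) : rel V := fun x y =>
  if (x == g) || (y == g) then e y x else e x y.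

Definition poset_iso (S T : finType) (A : {set S}) (leA : rel S)
    (B : {set T}) (leB : rel T) (f : S -> T) : Prop :=
  [/\ {in A &, injective f}, f @: A = B
    & {in A &, forall x y, leB (f x) (f y) = leA x y}].

(* Main.v *)
Require Import Defs.
From HB Require Import structures.
From mathcomp Require Import all_boot.

Set Implicit Arguments.
Unset Strict Implicit.
Unset Printing Implicit Defensive.

(** Call a pair of disjoint sets (D, U) greedy when a vertex k lies in their
    union exactly if no edge goes from D to k and no edge goes from k to U.
    This local condition describes the tops that matter: a greedy pair is a
    top ([greedy_is_top]), either component of a greedy pair determines the
    other and may be any independent set ([greedy_eqD], [greedy_eqU],
    [greedy_completion]), and a top one of whose components has at most one
    element is greedy ([top_small_U_greedy]).  A flip of a greedy pair is
    greedy ([flipP]).  So the endpoints of the intervals in the theorem are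
    greedy, and so is everything above a greedy pair.

    A flip at h can also be described without the algorithm ([step],
    [flip_stepP]): it is the only greedy pair in which h has moved from U to D
    and which keeps D outside the vertices below h and U outside the vertices
    above h.  In particular the choice of linear extensions is immaterial.  A
    flip increases D lexicographically along a reverse linear extension
    ([step_bits]), so repeated flips at chosen vertices terminate.  If g is a
    sink, a flip at h <> g does not change whether g is in U, and a flip at g
    removes it.  Flipping up until U is contained in {g}, or down until D is
    contained in {g}, then shows that [0, m_g] consists of the greedy pairs
    with g in U and [j_g, 1] of those with g not in U ([sink_below],
    [sink_above]); dually, for a source the membership of g in D separates
    [j_g, 1] from [0, m_g] ([source_above], [source_below]).

    Let g be a sink of e and a source of e', where e' is e with the edges at
    g reversed.  Relate x for e and x' for e' when they agree away from g and
    g is in the U-part of x iff it is in the D-part of x' ([toggled]).  An edge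
    from k to g forbids k when g is in U, and the reversed edge forbids k when
    g is in D, so related pairs have the same greedy condition at every vertex
    other than g ([toggled_free]), while the condition at g fixes the remaining
    membership of g.  The relation is therefore a bijection between the greedy
    pairs of e and those of e'.  It preserves steps within each of the two
    intervals, since reachability between vertices other than g is the same
    for e and e' ([connect_toggle], [step_toggled], [step_toggled_inv]).  Read
    from e to e' this gives the statements on a minimal vertex, and read from
    e' to e those on a maximal one. *)

(** * Greedy passes along an ordering *)

Lemma pairwise_index (T : eqType) (a : rel T) (s : seq T) :
  uniq s -> (forall i j, a i j -> index i s < index j s) ->
  pairwise (fun i j => ~~ a j i) s.
Proof.
case: s => [//|x0 s] Us Hs; apply/(pairwiseP x0) => i j Hi Hj ij.
apply/negP => /Hs; rewrite !index_uniq // => ji.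
by have := ltn_trans ij ji; rewrite ltnn.
Qed.

(** The recursive acceptance test only sees the set built so far, but no later
    element of s has an edge to an earlier one, so testing against the final
    set gives the same answer. *)
Lemma foldl_greedy (V : finType) (a : rel V) (P : pred V)
    (add : {set V} -> V -> {set V}) (S0 : {set V}) (s : seq V) :
  (forall S k,
     add S k = if P k && [forall d in S, ~~ a d k] then k |: S else S) ->
  irreflexive a -> pairwise (fun i j => ~~ a j i) s ->
  forall k, (k \in foldl add S0 s) =
    (k \in S0) ||
    [&& k \in s, P k & [forall d in foldl add S0 s, ~~ a d k]].
Proof.
move=> addE irr; elim/last_ind: s => [|s j IH] pw k; first by rewrite orbF.
move: pw; rewrite pairwise_rcons => /andP[/allP sj /IH {}IH].
rewrite foldl_rcons addE; set S := foldl add S0 s in IH *.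
rewrite mem_rcons inE; case: ifP => [/andP[Pj Sj]|nj].
  have jS i : (i \in j :: s) -> [forall d in j |: S, ~~ a d i] =
      [forall d in S, ~~ a d i].
    rewrite inE => ks; apply/forall_inP/forall_inP => H d Hd.
      by apply: H; rewrite !inE Hd orbT.
    move: Hd; rewrite !inE => /orP[/eqP ->|]; last exact: H.
    case/orP: ks => [/eqP ->|/sj //]; by rewrite irr.
  rewrite !inE; have [->|kj] /= := eqVneq k j.
    by rewrite Pj jS ?inE ?eqxx // Sj orbT.
  rewrite IH; case ks: (k \in s) => //=.
  by rewrite jS // inE ks orbT.
have [->|kj] /= := eqVneq k j; last exact: IH.
by rewrite IH nj andbF.
Qed.

(** * Greedy pairs *)

Section Greedy.

Variables (V : finType) (e : rel V).
Implicit Types (x y : {set V} * {set V}) (h k d u : V).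

Definition free x k :=
  [forall d in x.1, ~~ e d k] && [forall u in x.2, ~~ e k u].

Definition greedy x :=
  [disjoint x.1 & x.2] && [forall k, (k \in x.1 :|: x.2) == free x k].

Lemma freeP x k :
  reflect ((forall d, d \in x.1 -> ~~ e d k) /\
           (forall u, u \in x.2 -> ~~ e k u)) (free x k).
Proof. by apply: (iffP andP) => -[/forall_inP ? /forall_inP]. Qed.

Lemma greedy_free x k : greedy x -> (k \in x.1) || (k \in x.2) = free x k.
Proof. by case/andP=> _ /forallP/(_ k)/eqP; rewrite inE. Qed.

Lemma greedy_disj x k : greedy x -> k \in x.1 -> k \in x.2 = false.
Proof. by case/andP=> /disjointFr H _ /H. Qed.

Lemma greedy_no_edgeD x d k : greedy x ->
  (k \in x.1) || (k \in x.2) -> d \in x.1 -> e d k = false.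
Proof. by move=> gx; rewrite greedy_free // => /freeP[H _] /H/negbTE. Qed.

Lemma greedy_no_edgeU x u k : greedy x ->
  (k \in x.1) || (k \in x.2) -> u \in x.2 -> e k u = false.
Proof. by move=> gx; rewrite greedy_free // => /freeP[_ H] /H/negbTE. Qed.

Lemma greedyI x :
  (forall k, k \in x.1 -> k \notin x.2) ->
  (forall k, (k \in x.1) || (k \in x.2) = free x k) -> greedy x.
Proof.
move=> H1 H2; apply/andP; split; last by apply/forallP => k; rewrite inE H2.
by apply/pred0P => k /=; apply/negP => /andP[/H1/negP].
Qed.

Lemma greedy_memD x k : greedy x ->
  (k \in x.1) = (k \notin x.2) && free x k.
Proof.
move=> gx; rewrite -greedy_free //.
by case D: (k \in x.1); [rewrite (greedy_disj gx D) | case: (k \in x.2)].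
Qed.

Lemma greedy_memU x k : greedy x ->
  (k \in x.2) = (k \notin x.1) && free x k.
Proof.
move=> gx; rewrite -greedy_free //.
by case D: (k \in x.1); [rewrite (greedy_disj gx D) |].
Qed.

End Greedy.

(** Reversing all edges and exchanging D with U is a symmetry of the theory;
    it turns statements about D into statements about U. *)
Definition dual (V : finType) (x : {set V} * {set V}) := (x.2, x.1).

Lemma greedy_dual (V : finType) (e : rel V) x :
  greedy (fun a b => e b a) (dual x) = greedy e x.
Proof.
rewrite /greedy /free /= disjoint_sym setUC; congr (_ && _).
by apply: eq_forallb => k; rewrite andbC.
Qed.

(** * Greedy pairs are tops *)

Section Orthogonal.

Variables (V : finType) (e : rel V).
Implicit Types (D U : {set V}).

Lemma orthogonalP D U :
  reflect [/\ forall k, k \in D -> k \notin U,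
              forall a b, a \in D -> b \in D -> ~~ e a b,
              forall a b, a \in U -> b \in U -> ~~ e a b
            & forall a b, a \in D -> b \in U -> ~~ e a b]
          (orthogonal e D U).
Proof.
apply: (iffP and4P) => -[H1 H2 H3 H4]; split.
- by move=> k kD; rewrite (disjointFr H1 kD).
- by move=> a b aD bD; move/forall_inP/(_ a aD)/forall_inP: H2; apply.
- by move=> a b aD bD; move/forall_inP/(_ a aD)/forall_inP: H3; apply.
- by move=> a b aD bD; move/forall_inP/(_ a aD)/forall_inP: H4; apply.
- by apply/pred0P => k /=; apply/negP => /andP[/H1/negP].
- by do 2![apply/forall_inP => ? ?]; apply: H2.
- by do 2![apply/forall_inP => ? ?]; apply: H3.
- by do 2![apply/forall_inP => ? ?]; apply: H4.
Qed.

Lemma greedy_orthogonal x : greedy e x -> orthogonal e x.1 x.2.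
Proof.
move=> gx; apply/orthogonalP; split.
- by move=> k /(greedy_disj gx) ->.
- by move=> a b aD bD; rewrite (greedy_no_edgeD gx _ aD) ?bD.
- by move=> a b aU bU; rewrite (greedy_no_edgeU gx _ bU) ?aU ?orbT.
- by move=> a b aD bU; rewrite (greedy_no_edgeD gx _ aD) ?bU ?orbT.
Qed.

End Orthogonal.

Section Acyclic.

Variables (V : finType) (e : rel V) (l r : seq V).
Hypotheses (El : linear_extension e l) (Er : reverse_linear_extension e r).
Implicit Types (x y : {set V} * {set V}) (h k d u : V).

Lemma connect_index h k : connect e h k -> index h r <= index k r.
Proof.
case/connectP => p; elim: p h => [h _ -> //|j p IH h /= /andP[hj pj] Ek].
by apply: leq_trans (ltnW (proj2 Er _ _ hj)) (IH _ pj Ek).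
Qed.

Lemma edge_not_back h k : e h k -> connect e k h = false.
Proof.
move=> hk; apply/negP => /connect_index; rewrite leqNgt.
by rewrite (proj2 Er _ _ hk).
Qed.

Lemma edge_irr : irreflexive e.
Proof.
by move=> k; apply/negP => kk; have := edge_not_back kk; rewrite connect0.
Qed.

Lemma connect_anti h k : connect e h k -> connect e k h -> h = k.
Proof.
case/connectP => -[|j p] /=; first by move=> _ ->.
case/andP=> hj pj Ek kh; have := edge_not_back hj.
suff -> : connect e j h by [].
by apply: connect_trans kh; apply/connectP; exists p.
Qed.

Lemma below_edge h j k : e j k -> connect e h k = false -> connect e h j = false.
Proof.
by move=> jk; apply: contraFF => hj; apply: connect_trans hj (connect1 jk).
Qed.

Lemma above_edge h j k : e j k -> connect e j h = false -> connect e k h = false.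
Proof.
by move=> jk; apply: contraFF; apply: connect_trans (connect1 jk).
Qed.

Lemma mem_l k : k \in l. Proof. by rewrite (perm_mem (proj1 El)) mem_enum. Qed.
Lemma mem_r k : k \in r. Proof. by rewrite (perm_mem (proj1 Er)) mem_enum. Qed.

Lemma pairwise_l : pairwise (fun i j => ~~ e i j) l.
Proof.
apply: (@pairwise_index _ (fun i j => e j i)).
  by rewrite (perm_uniq (proj1 El)) enum_uniq.
by move=> i j; apply: (proj2 El).
Qed.

Lemma pairwise_r : pairwise (fun i j => ~~ e j i) r.
Proof.
apply: pairwise_index; first by rewrite (perm_uniq (proj1 Er)) enum_uniq.
exact: (proj2 Er).
Qed.

(** An insertion or replacement that puts k into D or U must fail: as k was
    outside both sets, an edge d -> k or k -> u excludes it, and the element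
    replaced is not its other end, because that edge points against the
    direction of the replacement. *)
Lemma greedy_is_top x : greedy e x -> is_top e x.
Proof.
move=> gx; rewrite /is_top greedy_orthogonal //=.
have out k : k \notin x.1 -> k \notin x.2 ->
    (exists2 d, d \in x.1 & e d k) \/ (exists2 u, u \in x.2 & e k u).
  move=> /negbTE nD /negbTE nU; have := greedy_free k gx.
  rewrite nD nU /= => /esym/negbT; rewrite negb_and.
  by case/orP=> /forall_inPn[j jx /negPn ekj]; [left|right]; exists j.
apply/and4P; split.
- apply/forall_inP => d dD; apply/forallP => d'; apply/implyP.
  case/andP=> /andP[d'D dd'] cdd'; apply/orthogonalP => -[H1 H2 H3 H4].
  have dn : d' \in d' |: x.1 :\ d by rewrite !inE eqxx.
  case: (out d' d'D (H1 _ dn)) => -[j jx ej]; last first.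
    by have := H4 _ _ dn jx; rewrite ej.
  have jn : j \in d' |: x.1 :\ d.
    rewrite !inE jx andbT; apply/orP; right; apply/negP => /eqP Ej.
    by have := edge_not_back ej; rewrite Ej cdd'.
  by have := H2 _ _ jn dn; rewrite ej.
- apply/forall_inP => u uU; apply/forallP => u'; apply/implyP.
  case/andP=> /andP[u'U uu'] cuu'; apply/orthogonalP => -[H1 H2 H3 H4].
  have un : u' \in u' |: x.2 :\ u by rewrite !inE eqxx.
  have u'D : u' \notin x.1 by apply/negP => /H1/negP.
  case: (out u' u'D u'U) => -[j jx ej].
    by have := H4 _ _ jx un; rewrite ej.
  have jn : j \in u' |: x.2 :\ u.
    rewrite !inE jx andbT; apply/orP; right; apply/negP => /eqP Ej.
    by have := edge_not_back ej; rewrite Ej cuu'.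
  by have := H3 _ _ un jn; rewrite ej.
- apply/forallP => d; apply/implyP => dD; apply/orthogonalP => -[H1 H2 H3 H4].
  have dn : d \in d |: x.1 by rewrite !inE eqxx.
  case: (out d dD (H1 _ dn)) => -[j jx ej].
    by have := H2 j d; rewrite ej !inE jx eqxx orbT => /(_ isT isT).
  by have := H4 _ _ dn jx; rewrite ej.
- apply/forallP => u; apply/implyP => uU; apply/orthogonalP => -[H1 H2 H3 H4].
  have un : u \in u |: x.2 by rewrite !inE eqxx.
  have uD : u \notin x.1 by apply/negP => /H1/negP.
  case: (out u uD uU) => -[j jx ej].
    by have := H4 _ _ jx un; rewrite ej.
  by have := H3 u j; rewrite ej !inE jx eqxx orbT => /(_ isT isT).
Qed.

(** U is filled greedily from the bottom up; the condition at the elements of D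
    then holds because nothing with an edge from D enters U. *)
Lemma greedy_completion (D : {set V}) : independent e D ->
  exists U, greedy e (D, U).
Proof.
move=> iD; pose P k := (k \notin D) && [forall d in D, ~~ e d k].
pose add (S : {set V}) k :=
  if P k && [forall u in S, ~~ e k u] then k |: S else S.
have UE := foldl_greedy (a := fun i j => e j i) set0 (add := add)
  (fun _ _ => erefl) edge_irr pairwise_l.
set U := foldl _ _ _ in UE; exists U.
have {}UE k : (k \in U) =
    [&& k \notin D, [forall d in D, ~~ e d k] & [forall u in U, ~~ e k u]].
  by rewrite UE inE mem_l /P -andbA.
apply: greedyI => /= k; first by move=> kD; rewrite UE kD.
rewrite /free /= UE; have [kD|//] := boolP (k \in D).
apply/esym/andP; split; apply/forall_inP.
  by move=> d dD; move/forall_inP/(_ d dD)/forall_inP/(_ k kD): iD.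
by move=> u; rewrite UE => /and3P[_ /forall_inP/(_ k kD)].
Qed.

(** Given D, membership of k in U depends only on the part of U below k, so U is
    found by recursion along a linear extension. *)
Lemma greedy_eqD x y : greedy e x -> greedy e y -> x.1 = y.1 -> x = y.
Proof.
case: x y => D U [D' U'] gx gy /= ED; subst D'; congr (_, _).
apply/setP => k; have [n] := ubnP (index k l); elim: n k => // n IH k kn.
rewrite (greedy_memU _ gx) (greedy_memU _ gy) /free /=.
congr (_ && (_ && _)); apply: eq_forallb => u.
by case ku: (e k u); rewrite ?implybT // IH // (leq_trans (proj2 El _ _ ku)).
Qed.

End Acyclic.

Lemma linear_extension_dual (V : finType) (e : rel V) s :
  reverse_linear_extension e s -> linear_extension (fun a b => e b a) s.
Proof. by case=> Hp H; split=> // a b /H. Qed.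

Lemma reverse_linear_extension_dual (V : finType) (e : rel V) s :
  linear_extension e s -> reverse_linear_extension (fun a b => e b a) s.
Proof. by case=> Hp H; split=> // a b /H. Qed.

(** * Flips *)

Section Flips.

Variables (V : finType) (e : rel V) (l r : seq V).
Hypotheses (El : linear_extension e l) (Er : reverse_linear_extension e r).
Implicit Types (x y : {set V} * {set V}) (h k d u : V).

Lemma greedy_eqU x y : greedy e x -> greedy e y -> x.2 = y.2 -> x = y.
Proof.
rewrite -greedy_dual -(greedy_dual e y) => gx gy E.
have := greedy_eqD (linear_extension_dual Er) gx gy E.
by case: x y {gx gy E} => ? ? [? ?] [-> ->].
Qed.

(** The flip of x at an element h of its second component, described by what
    it fixes instead of by how it is computed. *)
Definition step h x y : Prop :=
  [/\ greedy e x, greedy e y, (h \in x.2) && (h \in y.1),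
      forall k, connect e h k = false -> (k \in y.1) = (k \in x.1)
    & forall k, connect e k h = false -> (k \in y.2) = (k \in x.2)].

(** U is fixed at all vertices not above h, so D can be recovered at the vertices
    below h from the top down; D then determines U. *)
Lemma step_inj h x y z : step h x y -> step h x z -> y = z.
Proof.
case=> gx gy /andP[hx hy] D1 U1 [_ gz /andP[_ hz] D2 U2].
apply: (greedy_eqD El) => //; apply/setP => k.
have [n] := ubnP (index k r); elim: n k => // n IH k kn.
case hk: (connect e h k); last by rewrite D1 // D2.
have [-> |nkh] := eqVneq k h; first by rewrite hy hz.
have kh : connect e k h = false.
  by apply/negP => /(connect_anti Er hk) E; rewrite E eqxx in nkh.
rewrite (greedy_memD _ gy) (greedy_memD _ gz) U1 // U2 // /free.
congr (_ && (_ && _)); apply: eq_forallb => j.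
  by case jk: (e j k); rewrite ?implybT // IH // (leq_trans (proj2 Er _ _ jk)).
case kj: (e k j); rewrite ?implybT // U1 ?U2 //; exact: above_edge kj kh.
Qed.

(** Both directions of flipping are covered: h may lie in either component. For
    k incomparable to h or above it, D1 already contains every element of D
    with an edge to k, and for k incomparable to h or below it, U1 contains
    every element of U to which k has an edge; so the two passes only change D
    strictly below h and U strictly above h. *)
Lemma flipP h x : greedy e x -> (h \in x.1) || (h \in x.2) ->
  let y := flip e l r h x in
  [/\ greedy e y, (h \in y.1) = (h \in x.2), (h \in y.2) = (h \in x.1),
      forall k, connect e h k = false -> (k \in y.1) = (k \in x.1)
    & forall k, connect e k h = false -> (k \in y.2) = (k \in x.2)].
Proof.
case: x => D U gx hx; rewrite /flip inE /= hx /=.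
set D1 := (if h \in U then _ else _).
set U1 := (if h \in D then _ else _).
set addD := (fun (D' : {set V}) k => if _ then _ else _).
set D2 := foldl addD D1 r.
set addU := (fun (U' : {set V}) k => if _ then _ else _).
set U2 := foldl addU U1 l.
have D1E k : (k \in D1) =
    (k == h) && (h \in U) || (k \in D) && ~~ connect e h k.
  by rewrite /D1; case: ifP; rewrite !inE ?andbT ?andbF.
have U1E k : (k \in U1) =
    (k == h) && (h \in D) || (k \in U) && ~~ connect e k h.
  by rewrite /U1; case: ifP; rewrite !inE ?andbT ?andbF.
have D2E k : (k \in D2) = (k \in D1) ||
    [&& ~~ connect e k h, k \notin U1, [forall u in U1, ~~ e k u]
      & [forall d in D2, ~~ e d k]].
  pose P k := [&& ~~ connect e k h, k \notin U1 & [forall u in U1, ~~ e k u]].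
  rewrite /D2 (foldl_greedy (a := e) (P := P) _ _ (edge_irr Er) (pairwise_r Er)).
    by rewrite (mem_r Er) /P -!andbA.
  by move=> S j; rewrite /P -!andbA.
have U2E k : (k \in U2) = (k \in U1) ||
    [&& ~~ connect e h k, k \notin D2, [forall d in D2, ~~ e d k]
      & [forall u in U2, ~~ e k u]].
  pose P k := [&& ~~ connect e h k, k \notin D2 & [forall d in D2, ~~ e d k]].
  rewrite /U2 (foldl_greedy (a := fun i j => e j i) (P := P) _ _
                 (edge_irr Er) (pairwise_l El)).
    by rewrite (mem_l El) /P -!andbA.
  by move=> S j; rewrite /P -!andbA.
clearbody D2 U2; clear addD addU.
have sD k : k \in D1 -> k \in D2 by rewrite D2E => ->.
have sU k : k \in U1 -> k \in U2 by rewrite U2E => ->.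
have DE k : connect e h k = false -> (k \in D2) = (k \in D).
  move=> hk; apply/idP/idP => [|kD]; last by rewrite sD // D1E kD hk orbT.
  rewrite D2E D1E hk andbT; case: eqVneq => [Ek|_] /=.
    by rewrite Ek connect0 in hk.
  case/orP=> // /and4P[/negbTE kh kU1 /forall_inP ndU /forall_inP ndD].
  have := greedy_memD k gx; rewrite /= => ->; apply/andP; split.
    by apply: contra kU1 => kU; rewrite U1E kU kh orbT.
  apply/freeP; split=> j /= jx; apply/negP => ej.
    suff /ndD : j \in D2 by rewrite ej.
    by rewrite sD // D1E jx (below_edge ej hk) orbT.
  suff /ndU : j \in U1 by rewrite ej.
  by rewrite U1E jx (above_edge ej kh) orbT.
have UE k : connect e k h = false -> (k \in U2) = (k \in U).
  move=> kh; apply/idP/idP => [|kU]; last by rewrite sU // U1E kU kh orbT.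
  rewrite U2E U1E kh andbT; case: eqVneq => [Ek|_] /=.
    by rewrite Ek connect0 in kh.
  case/orP=> // /and4P[/negbTE hk kD2 /forall_inP ndD /forall_inP ndU].
  have := greedy_memU k gx; rewrite /= => ->; apply/andP; split.
    by apply: contra kD2 => kD; rewrite DE.
  apply/freeP; split=> j /= jx; apply/negP => ej.
    suff /ndD : j \in D2 by rewrite ej.
    by rewrite DE // (below_edge ej hk).
  suff /ndU : j \in U2 by rewrite ej.
  by rewrite sU // U1E jx (above_edge ej kh) orbT.
have hD : (h \in D2) = (h \in U).
  by rewrite D2E D1E connect0 eqxx /= andbF !orbF.
have hU : (h \in U2) = (h \in D).
  by rewrite U2E U1E connect0 eqxx /= andbF !orbF.
have noD k d : (k \in D) || (k \in U) -> d \in D -> e d k = false.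
  exact: (greedy_no_edgeD gx).
have noU k u : (k \in D) || (k \in U) -> u \in U -> e k u = false.
  exact: (greedy_no_edgeU gx).
split=> //; apply: greedyI => /= k.
  move=> kD2; apply/negP => kU2.
  case kh: (connect e k h); case hk: (connect e h k).
  - have E := connect_anti Er kh hk; subst k.
    by have /= := greedy_disj (k := h) gx; rewrite -hU -hD kU2 kD2 => /(_ isT).
  - move: kU2; rewrite U2E kD2 U1E kh hk /= !andbF !orbF => /andP[/eqP E].
    by rewrite E connect0 in hk.
  - move: kD2 (kU2); rewrite D2E UE // D1E hk kh /= andbF orbF => H kU.
    case/orP: H => [/andP[/eqP E]|/andP[]]; first by rewrite E connect0 in kh.
    by rewrite U1E kU kh orbT.
  - move: kD2 kU2; rewrite UE // DE // => /(greedy_disj gx) /=.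
    by move=> ->.
apply/idP/freeP => /=.
  move=> kin; split=> j jin; apply/negP => ej.
    have jh := edge_not_back Er ej.
    case/orP: kin; rewrite ?D2E ?U2E.
      case/orP=> [|/and4P[_ _ _ /forall_inP/(_ j jin)]]; last by rewrite ej.
      rewrite D1E => /orP[/andP[/eqP Ek hUU]|/andP[kD /negbTE hk]].
        subst k; rewrite DE // in jin.
        by rewrite (noD h) ?hUU ?orbT in ej.
      by rewrite DE ?(below_edge ej hk) // in jin; rewrite (noD k) ?kD in ej.
    case/orP=> [|/and4P[_ _ /forall_inP/(_ j jin)]]; last by rewrite ej.
    rewrite U1E => /orP[/andP[/eqP Ek hDD]|/andP[kU /negbTE kh]].
      subst k; rewrite DE // in jin.
      by rewrite (noD h) ?hDD ?orbT in ej.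
    move: jin; rewrite D2E D1E -orbA => /or3P[/andP[/eqP Ej hUU]|/andP[jD _]|].
    - by subst j; rewrite (noU h) ?hUU ?orbT in ej.
    - by rewrite (noD k) ?kU ?orbT in ej.
    case/and4P=> _ _ /forall_inP H _; suff /H : k \in U1 by rewrite ej.
    by rewrite U1E kU kh orbT.
  have jh := edge_not_back Er ej.
  case/orP: kin; rewrite ?D2E ?U2E; last first.
    case/orP=> [|/and4P[_ _ _ /forall_inP/(_ j jin)]]; last by rewrite ej.
    rewrite U1E => /orP[/andP[/eqP Ek hDD]|/andP[kU /negbTE kh]].
      subst k; rewrite UE // in jin.
      by rewrite (noU h) ?hDD in ej.
    by rewrite UE ?(above_edge ej kh) // in jin; rewrite (noU k) ?kU ?orbT in ej.
  case/orP=> [|/and4P[/negbTE kh _ /forall_inP H _]]; last first.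
    have jh' := above_edge ej kh; suff /H : j \in U1 by rewrite ej.
    by rewrite UE // in jin; rewrite U1E jin jh' orbT.
  rewrite D1E => H; move: (H) => /orP[/andP[/eqP Ek hUU]|/andP[kD /negbTE hk]].
    subst k; rewrite UE // in jin.
    by rewrite (noU h) ?hUU ?orbT in ej.
  move: jin; rewrite U2E U1E -orbA => /or3P[/andP[/eqP Ej hDD]|/andP[jU _]|].
  - by subst j; rewrite (noD h) ?hDD in ej.
  - by rewrite (noU k) ?kD in ej.
  case/and4P=> _ _ /forall_inP H' _; suff /H' : k \in D2 by rewrite ej.
  by rewrite sD // D1E H.
case=> nD nU.
have [Ek|nkh] := eqVneq k h; first by rewrite Ek hD hU orbC.
case hk: (connect e h k); last first.
  rewrite [k \in U2]U2E hk /=; case: (k \in D2) => //=; apply/orP; right.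
  by apply/andP; split; apply/forall_inP => j; [apply: nD | apply: nU].
have kh : connect e k h = false.
  by apply/negP => /(connect_anti Er hk) E; rewrite E eqxx in nkh.
rewrite [k \in D2]D2E kh /=.
case kU: (k \in U1); first by rewrite (sU _ kU) !orbT.
apply/orP; left; apply/orP; right => /=.
by apply/andP; split; apply/forall_inP => j; [move/sU; apply: nU | apply: nD].
Qed.

Lemma step_flip h x : greedy e x -> h \in x.2 -> step h x (flip e l r h x).
Proof.
move=> gx hx; have [|gy h1 h2 D U] := @flipP h x gx; first by rewrite hx orbT.
by split; rewrite // h1 hx.
Qed.

(** The conditions that a step imposes away from h are symmetric in its two
    ends, so flipping at an element of D produces a step in the opposite
    direction. *)
Lemma flip_step_down h x : greedy e x -> h \in x.1 -> step h (flip e l r h x) x.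
Proof.
move=> gx hx; have [|gy h1 h2 D U] := @flipP h x gx; first by rewrite hx.
by split; rewrite // ?h2 ?hx // => k Hk; rewrite (D, U).
Qed.

Lemma flip_stepP x y :
  greedy e x -> reflect (exists h, step h x y) (flip_step e l r x y).
Proof.
move=> gx; apply: (iffP and3P) => [[_ _ /exists_inP[h hx /eqP ->]]|[h]].
  by exists h; apply: step_flip.
move=> st; have [_ gy /andP[hx _] _ _] := st.
split; [exact: (greedy_is_top Er) | exact: (greedy_is_top Er) |].
by apply/exists_inP; exists h => //; apply/eqP/(step_inj st)/step_flip.
Qed.

Lemma step_le h x y : step h x y -> top_le e l r x y.
Proof.
move=> st; apply/connect1/flip_stepP; first by case: st.
by exists h.
Qed.

Lemma top_le_ind (P : {set V} * {set V} -> {set V} * {set V} -> Prop) :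
  (forall x, greedy e x -> P x x) ->
  (forall h x y z, step h x y -> top_le e l r y z -> P y z -> P x z) ->
  forall x y, greedy e x -> top_le e l r x y -> P x y.
Proof.
move=> P0 P1 x y gx /connectP[p]; elim: p x gx => [x gx _ -> |z p IH x gx /=].
  exact: P0.
case/andP=> /(flip_stepP _ gx)[h st] pz Ey.
apply: (P1 h _ z) => //; first by apply/connectP; exists p.
by apply: IH => //; case: st.
Qed.

Lemma top_le_greedy x y : greedy e x -> top_le e l r x y -> greedy e y.
Proof.
move=> gx lexy.
by apply: (top_le_ind (P := fun _ y => greedy e y)) gx lexy.
Qed.

(** The binary number whose digits, most significant first, are n followed by the
    membership bits of the entries of s in D: comparing these numbers compares
    sets lexicographically. *)
Fixpoint bits (D : {set V}) (s : seq V) n :=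
  if s is k :: s' then bits D s' (n.*2 + (k \in D)) else n.

Lemma bits_lt (D D' : {set V}) s m n : m < n -> bits D s m < bits D' s n.
Proof.
elim: s m n => //= k s IH m n mn; apply: IH.
apply: (@leq_trans n.*2); last exact: leq_addr.
rewrite (leq_trans _ (_ : m.+1.*2 <= n.*2)) ?leq_double //.
by rewrite doubleS ltnS -addn1 leq_add2l leq_b1.
Qed.

Lemma bits_first (D D' : {set V}) s n h :
  h \in s -> h \notin D -> h \in D' ->
  (forall k, index k s < index h s -> (k \in D) = (k \in D')) ->
  bits D s n < bits D' s n.
Proof.
move=> + hD hD'; elim: s n => //= k s IH n hs agree.
have [Ekh|kh] := eqVneq k h.
  by apply: bits_lt; rewrite Ekh hD' (negbTE hD) addn0 addn1.
move: hs agree; rewrite inE eq_sym (negbTE kh) /= => hs agree.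
rewrite -(agree k) ?eqxx //; apply: IH => // j ji.
by apply: agree; case: (k == j).
Qed.

(** A vertex before h in a reverse linear extension is not below h, so h is the
    first place where D changes, and there it gains an element. *)
Lemma step_bits h x y : step h x y -> bits x.1 r 0 < bits y.1 r 0.
Proof.
case=> gx gy /andP[hx hy] D _; apply: (@bits_first _ _ _ _ h) => //.
- exact: mem_r Er h.
- by rewrite (greedy_memD _ gx) hx.
move=> k kh; rewrite D //; apply/negP => /(connect_index Er).
by rewrite leqNgt kh.
Qed.

(** Among the pairs above x with property P, one with the largest [bits] admits
    no flip at a vertex outside K. *)
Lemma ascend (K : {set V}) (P : pred ({set V} * {set V})) x :
  (forall h y z, h \notin K -> step h y z -> P y -> P z) ->
  greedy e x -> P x ->
  exists y, [/\ top_le e l r x y, greedy e y, P y & y.2 \subset K].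
Proof.
move=> HP gx Px; pose Q y := [&& top_le e l r x y, P y & greedy e y].
have Qx : Q x by apply/and3P; split=> //; apply: connect0.
case: (arg_maxnP (fun y => bits y.1 r 0) Qx) => y /and3P[xy Py gy] ymax.
exists y; split=> //; apply/subsetP => h hy; apply/negPn/negP => hK.
have st := step_flip gy hy.
have := step_bits st; rewrite ltnNge => /negP[]; apply: ymax.
apply/and3P; split; [|exact: HP hK st Py|by case: st].
exact: connect_trans xy (step_le st).
Qed.

Lemma descend (K : {set V}) (P : pred ({set V} * {set V})) x :
  (forall h y z, h \notin K -> step h y z -> P z -> P y) ->
  greedy e x -> P x ->
  exists y, [/\ top_le e l r y x, greedy e y, P y & y.1 \subset K].
Proof.
move=> HP gx Px; pose Q y := [&& top_le e l r y x, P y & greedy e y].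
have Qx : Q x by apply/and3P; split=> //; apply: connect0.
case: (arg_minnP (fun y => bits y.1 r 0) Qx) => y /and3P[yx Py gy] ymin.
exists y; split=> //; apply/subsetP => h hy; apply/negPn/negP => hK.
have st := flip_step_down gy hy.
have := step_bits st; rewrite ltnNge => /negP[]; apply: ymin.
apply/and3P; split; [|exact: HP hK st Py|by case: st].
exact: connect_trans (step_le st) yx.
Qed.

End Flips.

(** * Tops with a prescribed small component *)

Lemma connect_dual (V : finType) (e : rel V) a b :
  connect (fun a b => e b a) a b = connect e b a.
Proof. exact: (connect_rev e a b). Qed.

Lemma orthogonal_dual (V : finType) (e : rel V) (D U : {set V}) :
  orthogonal (fun a b => e b a) U D = orthogonal e D U.
Proof.
apply/orthogonalP/orthogonalP => -[H1 H2 H3 H4];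
  split=> [k kx|a b aS bS|a b aS bS|a b aS bS]; auto;
  by apply/negP => /H1/negP.
Qed.

Lemma is_top_dual (V : finType) (e : rel V) x :
  is_top (fun a b => e b a) (dual x) = is_top e x.
Proof.
rewrite /is_top orthogonal_dual; congr (_ && _).
have T (e0 : rel V) D U : tight e0 D U -> tight (fun a b => e0 b a) U D.
  case/and4P=> /forall_inP H1 /forall_inP H2 /forallP H3 /forallP H4.
  apply/and4P; split.
  - apply/forall_inP => u uU; apply/forallP => u'; rewrite orthogonal_dual.
    by rewrite connect_dual (forallP (H2 u uU)).
  - apply/forall_inP => d dD; apply/forallP => d'; rewrite orthogonal_dual.
    by rewrite connect_dual (forallP (H1 d dD)).
  - by apply/forallP => u; rewrite orthogonal_dual.
  - by apply/forallP => d; rewrite orthogonal_dual.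
by apply/idP/idP; [apply: (T (fun a b => e b a)) | apply: T].
Qed.

(** Suppose that the greedy condition fails at k, so that k is outside D and U
    although nothing excludes it. As U cannot be enlarged by k, there is an
    edge from an element u of U to k; and as u is the whole of U, replacing u
    by the smaller k leaves an orthogonal pair, against tightness. *)
Lemma top_small_U_greedy (V : finType) (e : rel V) x :
  irreflexive e -> is_top e x -> #|x.2| <= 1 -> greedy e x.
Proof.
case: x => D U irr /andP[/= ort /and4P[_ /forall_inP T2 _ /forallP T4]] U1.
have [H1 H2 H3 H4] := orthogonalP _ _ _ ort.
apply: greedyI => //= k; apply/idP/idP => [kx|/freeP[/= fD fU]].
  apply/freeP; split=> j jx; case/orP: kx => kx; auto.
apply/negPn; rewrite negb_or; apply/negP => /andP[kD kU].
move/implyP/(_ kU)/orthogonalP: (T4 k); apply; split=> //.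
- move=> j jD; rewrite !inE negb_or H1 // andbT.
  by apply: contra kD => /eqP <-.
- move=> a b; rewrite !inE => /orP[/eqP->|aU] /orP[/eqP->|bU]; rewrite ?irr //.
  + exact: fU.
  + apply/negP => ak; have ka : k != a by apply: contra kU => /eqP->.
    move/forallP/(_ k): (T2 a aU); rewrite kU ka connect1 //=.
    have -> : k |: U :\ a = [set k].
      apply/setP => j; rewrite !inE; case: eqVneq => //= jk.
      apply/negP => /andP[/eqP ja jU].
      by apply: ja; apply: (card_le1_eqP U1).
    case/orthogonalP; split=> //.
    * by move=> j jD; rewrite inE; apply: contra kD => /eqP <-.
    * by move=> ? ?; rewrite !inE => /eqP-> /eqP->; rewrite irr.
    * by move=> i j iD; rewrite inE => /eqP->; apply: fD.
  + exact: H3.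
- by move=> a b aD; rewrite !inE => /orP[/eqP->|bU]; [apply: fD|apply: H4].
Qed.

(** * The intervals [0, m_g] and [j_g, 1] *)

Section Intervals.

Variables (V : finType) (e : rel V) (l r : seq V).
Hypotheses (El : linear_extension e l) (Er : reverse_linear_extension e r).
Implicit Types (x y : {set V} * {set V}) (g h k d u : V).

Lemma independent_le1 (e0 : rel V) (I : {set V}) : irreflexive e0 ->
  #|I| <= 1 -> independent e0 I.
Proof.
move=> irr /card_le1_eqP I1; apply/forall_inP => i iI; apply/forall_inP => j jI.
by rewrite (I1 i j) ?irr.
Qed.

Lemma top_with_DP (I : {set V}) : #|I| <= 1 ->
  greedy e (top_with_D e I) /\ (top_with_D e I).1 = I.
Proof.
move=> I1; rewrite /top_with_D; case: pickP => [x /andP[tx /eqP xI]|no] /=.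
  split=> //; rewrite -greedy_dual.
  apply: top_small_U_greedy; rewrite ?is_top_dual /= ?xI //.
  by move=> k; apply: edge_irr Er k.
have [U gx] := greedy_completion El Er (independent_le1 (edge_irr Er) I1).
by have := no (I, U); rewrite (greedy_is_top Er) //= eqxx.
Qed.

Lemma top_with_UP (I : {set V}) : #|I| <= 1 ->
  greedy e (top_with_U e I) /\ (top_with_U e I).2 = I.
Proof.
move=> I1; rewrite /top_with_U; case: pickP => [x /andP[tx /eqP xI]|no] /=.
  split=> //; apply: top_small_U_greedy; rewrite ?xI //.
  exact: edge_irr Er.
have [|D gx] := greedy_completion (linear_extension_dual Er)
  (reverse_linear_extension_dual El) (D := I).
  by apply: independent_le1 => // k; apply: edge_irr Er k.
have gx' : greedy e (D, I) by rewrite -greedy_dual.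
by have := no (D, I); rewrite (greedy_is_top Er) //= eqxx.
Qed.

Lemma bottom_le x : greedy e x -> top_le e l r (top_with_D e set0) x.
Proof.
move=> gx.
have [//|y [yx gy _]] := descend El Er (K := set0) (P := predT) _ gx isT.
rewrite subset0 => /eqP y0; have [|gb b0] := @top_with_DP set0.
  by rewrite cards0.
by rewrite (greedy_eqD El gb gy) ?b0 ?y0.
Qed.

Lemma le_top x : greedy e x -> top_le e l r x (top_with_U e set0).
Proof.
move=> gx.
have [//|y [xy gy _]] := ascend El Er (K := set0) (P := predT) _ gx isT.
rewrite subset0 => /eqP y0; have [|gt t0] := @top_with_UP set0.
  by rewrite cards0.
by rewrite (greedy_eqU Er gt gy) ?t0 ?y0.
Qed.

Lemma step_closed_le (P : pred ({set V} * {set V})) :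
  (forall h x y, step e h x y -> P x -> P y) ->
  forall x y, greedy e x -> top_le e l r x y -> P x -> P y.
Proof.
move=> HP; apply: (top_le_ind El Er) => // h x y z /HP Pxy _ Pyz Px.
exact/Pyz/Pxy.
Qed.

(** If P is a down-set and only flips at g leave it, every pair in P can be
    flipped up inside P until U is contained in {g}; the last hypothesis then
    says that the end point is m_g. *)
Lemma top_belowE g (P : pred ({set V} * {set V})) :
  (forall h x y, step e h x y -> P y -> P x) ->
  (forall h x y, h != g -> step e h x y -> P x -> P y) ->
  (forall x, greedy e x -> x.2 \subset [set g] -> P x = (x.2 == [set g])) ->
  top_below e l r g = [set x | greedy e x && P x].
Proof.
move=> Pdown Pup Pg; apply/setP => x; rewrite !inE.
have [|gb _] := @top_with_DP set0; first by rewrite cards0.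
have [|gm mg] := @top_with_UP [set g]; first by rewrite cards1.
apply/and3P/andP => [[_ bx xm]|[gx Px]].
  have gx := top_le_greedy El Er gb bx; split=> //; apply/negPn/negP => nPx.
  have nP h y z : step e h y z -> predC P y -> predC P z.
    by move=> st; apply/contra/(Pdown _ _ _ st).
  by have := step_closed_le nP gx xm nPx; rewrite /= Pg // mg // eqxx.
split; [exact: (greedy_is_top Er) | exact: bottom_le |].
have [|y [xy gy Py yg]] := ascend El Er (K := [set g]) (P := P) _ gx Px.
  by move=> h y z; rewrite inE; apply: Pup.
by move: Py; rewrite Pg // => /eqP y2; rewrite (greedy_eqU Er gm gy) ?mg.
Qed.

Lemma top_aboveE g (P : pred ({set V} * {set V})) :
  (forall h x y, step e h x y -> P x -> P y) ->
  (forall h x y, h != g -> step e h x y -> P y -> P x) ->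
  (forall x, greedy e x -> x.1 \subset [set g] -> P x = (x.1 == [set g])) ->
  top_above e l r g = [set x | greedy e x && P x].
Proof.
move=> Pup Pdown Pg; apply/setP => x; rewrite !inE.
have [|gj jg] := @top_with_DP [set g]; first by rewrite cards1.
apply/and3P/andP => [[_ jx xt]|[gx Px]].
  have gx := top_le_greedy El Er gj jx; split=> //.
  by apply: (step_closed_le Pup gj jx); rewrite Pg // jg // eqxx.
split; [exact: (greedy_is_top Er) | | exact: le_top].
have [|y [yx gy Py yg]] := descend El Er (K := [set g]) (P := P) _ gx Px.
  by move=> h y z; rewrite inE; apply: Pdown.
by move: Py; rewrite Pg // => /eqP y1; rewrite (greedy_eqD El gj gy) ?jg.
Qed.

End Intervals.

(** * Reversing the edges at a sink *)

Section Toggle.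

Variables (V : finType) (e e' : rel V) (g : V) (l r l' r' : seq V).
Hypotheses (El : linear_extension e l) (Er : reverse_linear_extension e r).
Hypotheses (El' : linear_extension e' l') (Er' : reverse_linear_extension e' r').
Hypotheses (sink : forall k, e g k = false) (source : forall k, e' k g = false).
Hypotheses (swap : forall k, e' g k = e k g)
  (same : forall h k, h != g -> k != g -> e' h k = e h k).
Implicit Types (x y : {set V} * {set V}) (h k d u : V).

Lemma connect_sink k : connect e g k = (k == g).
Proof.
apply/idP/eqP => [|->]; last exact: connect0.
by case/connectP => -[_ ->|j p /=] //; rewrite sink.
Qed.

Lemma connect_source k : connect e' k g = (k == g).
Proof.
rewrite -connect_dual; apply/idP/eqP => [|->]; last exact: connect0.
by case/connectP => -[_ ->|j p /=] //; rewrite source.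
Qed.

Lemma step_sink_down h x y : step e h x y -> g \in y.2 -> g \in x.2.
Proof.
case=> gx gy /andP[hx hy] _ U gy2; have [<- //|gh] := eqVneq h g.
by rewrite -U // connect_sink (negbTE gh).
Qed.

Lemma step_sink_up h x y : h != g -> step e h x y -> g \in x.2 -> g \in y.2.
Proof.
by move=> gh [gx gy _ _ U] gx2; rewrite U // connect_sink (negbTE gh).
Qed.

Lemma step_source_up h x y : step e' h x y -> g \in x.1 -> g \in y.1.
Proof.
case=> gx gy /andP[hx hy] D _ gx1; have [<- //|gh] := eqVneq h g.
by rewrite D // connect_source (negbTE gh).
Qed.

Lemma step_source_down h x y : h != g -> step e' h x y -> g \in y.1 -> g \in x.1.
Proof.
by move=> gh [gx gy _ D _] gx1; rewrite -D // connect_source (negbTE gh).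
Qed.

Lemma sink_below :
  top_below e l r g = [set x | greedy e x && ((g \in x.2) == true)].
Proof.
apply: (top_belowE El Er) => [h x y|h x y|x gx xg]; rewrite ?eqb_id.
- exact: step_sink_down.
- exact: step_sink_up.
- by rewrite eqEsubset xg sub1set.
Qed.

(** A pair with D contained in {g} and g outside U has g in D, since nothing
    else could exclude g; this identifies the lower end of the interval. *)
Lemma sink_above :
  top_above e l r g = [set x | greedy e x && ((g \in x.2) == false)].
Proof.
apply: (top_aboveE El Er) => [h x y st|h x y hg st|x gx xg].
- by rewrite !eqbF_neg; apply/contra/(step_sink_down st).
- by rewrite !eqbF_neg; apply/contra/(step_sink_up hg st).
rewrite eqbF_neg eqEsubset xg sub1set (greedy_memU _ gx) negb_and negbK.
have [//|gx1] := boolP (g \in x.1); apply/negbF/freeP; split=> [d|u _].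
  by move/(subsetP xg); rewrite inE => /eqP->; rewrite sink.
by rewrite sink.
Qed.

Lemma source_above :
  top_above e' l' r' g = [set x | greedy e' x && ((g \in x.1) == true)].
Proof.
apply: (top_aboveE El' Er') => [h x y|h x y|x gx xg]; rewrite ?eqb_id.
- exact: step_source_up.
- exact: step_source_down.
- by rewrite eqEsubset xg sub1set.
Qed.

Lemma source_below :
  top_below e' l' r' g = [set x | greedy e' x && ((g \in x.1) == false)].
Proof.
apply: (top_belowE El' Er') => [h x y st|h x y hg st|x gx xg].
- by rewrite !eqbF_neg; apply/contra/(step_source_up st).
- by rewrite !eqbF_neg; apply/contra/(step_source_down hg st).
rewrite eqbF_neg eqEsubset xg sub1set (greedy_memD _ gx) negb_and negbK.
have [//|gx1] := boolP (g \in x.2); apply/negbF/freeP; split=> [d _|u].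
  by rewrite source.
by move/(subsetP xg); rewrite inE => /eqP->; rewrite source.
Qed.

(** Whether g lies in the D-part of x or the U-part of x' is left open: once the
    pairs are greedy it is forced. *)
Definition toggled x x' : Prop :=
  (forall k, k != g -> (k \in x'.1) = (k \in x.1) /\ (k \in x'.2) = (k \in x.2))
  /\ (g \in x.2) = (g \in x'.1).

(** A vertex k with an edge to g is excluded in x when g is in U, and in x',
    where the edge is reversed, when g is in D; all other edges at g point the
    wrong way to exclude k. *)
Lemma toggled_free x x' k : toggled x x' -> k != g -> free e' x' k = free e x k.
Proof.
case=> agree gE kg; apply/freeP/freeP => -[HD HU]; split=> j jx.
- have [->|jg] := eqVneq j g; first by rewrite sink.
  by rewrite -same // HD // (agree _ jg).1.
- have [Ej|jg] := eqVneq j g; first by rewrite Ej -swap HD // -gE -Ej.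
  by rewrite -same // HU // (agree _ jg).2.
- have [Ej|jg] := eqVneq j g; first by rewrite Ej swap HU // gE -Ej.
  by rewrite same // HD // -(agree _ jg).1.
- have [->|jg] := eqVneq j g; first by rewrite source.
  by rewrite same // HU // -(agree _ jg).2.
Qed.

Lemma toggled_greedy x x' : toggled x x' -> greedy e x ->
  (g \in x'.1 -> g \notin x'.2) ->
  (g \in x'.1) || (g \in x'.2) = free e' x' g -> greedy e' x'.
Proof.
move=> tx gx gD gF; apply: greedyI => k; have [->//|kg] := eqVneq k g.
  by have [-> ->] := tx.1 k kg => /(greedy_disj gx) ->.
by rewrite (toggled_free tx kg); have [-> ->] := tx.1 k kg; exact: greedy_free.
Qed.

Lemma toggled_greedy_inv x x' : toggled x x' -> greedy e' x' ->
  (g \in x.1 -> g \notin x.2) ->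
  (g \in x.1) || (g \in x.2) = free e x g -> greedy e x.
Proof.
move=> tx gx gD gF; apply: greedyI => k; have [->//|kg] := eqVneq k g.
  by have [<- <-] := tx.1 k kg => /(greedy_disj gx) ->.
by rewrite -(toggled_free tx kg); have [<- <-] := tx.1 k kg; exact: greedy_free.
Qed.

Lemma toggled_inj x y z :
  greedy e x -> greedy e y -> toggled x z -> toggled y z -> x = y.
Proof.
move=> gx gy [ax gxz] [ay gyz]; apply: (greedy_eqU Er gx gy).
apply/setP => k; have [->|kg] := eqVneq k g; first by rewrite gxz gyz.
by rewrite -(ax k kg).2 (ay k kg).2.
Qed.

Lemma toggled_fun x y z :
  greedy e' y -> greedy e' z -> toggled x y -> toggled x z -> y = z.
Proof.
move=> gx gy [ax gxz] [ay gyz]; apply: (greedy_eqD El' gx gy).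
apply/setP => k; have [->|kg] := eqVneq k g; first by rewrite -gxz gyz.
by rewrite (ax k kg).1 (ay k kg).1.
Qed.

(** When g is in neither the U-part of x nor the D-part of x', the other
    membership of g is decided by the edges between g and the rest of the pair:
    g enters the U-part of x' (here), or the D-part of x ([sink_D]), unless such
    an edge excludes it. *)
Definition source_U x := if [exists u in x.2, e u g] then x.2 else g |: x.2.
Definition sink_D y := if [exists d in y.1, e d g] then y.1 else g |: y.1.

Lemma toggled_move_up x : greedy e x -> g \in x.2 ->
  let x' := (g |: x.1, x.2 :\ g) in greedy e' x' /\ toggled x x'.
Proof.
move=> gx gx2 x'; have tx : toggled x x'.
  by split=> [k kg|]; rewrite !inE ?eqxx ?(negbTE kg).
split=> //; apply: (toggled_greedy tx) => //; rewrite !inE eqxx //=.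
apply/esym/freeP; split=> [d _|u]; first by rewrite source.
by rewrite inE swap => /andP[_ ux]; rewrite (greedy_no_edgeU gx) // ux orbT.
Qed.

Lemma toggled_move_down y : greedy e' y -> g \in y.1 ->
  let x := (y.1 :\ g, g |: y.2) in greedy e x /\ toggled x y.
Proof.
move=> gy gy1 x; have tx : toggled x y.
  by split=> [k kg|]; rewrite !inE ?eqxx ?(negbTE kg).
split=> //; apply: (toggled_greedy_inv tx) => //; rewrite !inE eqxx //=.
apply/esym/freeP; split=> [d|u _]; last by rewrite sink.
by rewrite inE -swap => /andP[_ dy]; rewrite (greedy_no_edgeD gy) // dy.
Qed.

Lemma toggled_complete_U x : greedy e x -> g \notin x.2 ->
  let x' := (x.1 :\ g, source_U x) in greedy e' x' /\ toggled x x'.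
Proof.
move=> gx gx2 x'; have tx : toggled x x'.
  split=> [k kg|]; last by rewrite !inE eqxx (negbTE gx2).
  by rewrite /x' /source_U; case: ifP; rewrite !inE kg ?(negbTE kg).
split=> //; apply: (toggled_greedy tx) => //; rewrite !inE eqxx //=.
rewrite /source_U; case: ifP => [/exists_inP[u ux ug]|nu].
  rewrite (negbTE gx2); apply/esym/freeP => -[_ /(_ u)].
  rewrite /x' /source_U ifT ?swap ?ug; first by move/(_ ux).
  by apply/exists_inP; exists u.
rewrite setU11; apply/esym/freeP; split=> [d _|u]; first by rewrite source.
rewrite /x' /source_U nu /= in_setU1 swap => /orP[/eqP->|ux]; first by rewrite sink.
by apply: contraFN nu => ug; apply/exists_inP; exists u.
Qed.

Lemma toggled_complete_D y : greedy e' y -> g \notin y.1 ->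
  let x := (sink_D y, y.2 :\ g) in greedy e x /\ toggled x y.
Proof.
move=> gy gy1 x; have tx : toggled x y.
  split=> [k kg|]; last by rewrite !inE eqxx (negbTE gy1).
  by rewrite /x /sink_D; case: ifP; rewrite !inE kg ?(negbTE kg).
split=> //; apply: (toggled_greedy_inv tx) => //; rewrite !inE eqxx ?orbF //=.
rewrite /sink_D; case: ifP => [/exists_inP[d dy dg]|nd].
  rewrite (negbTE gy1); apply/esym/freeP => -[/(_ d)].
  by rewrite /x /sink_D ifT ?dg; [move/(_ dy) | apply/exists_inP; exists d].
rewrite setU11; apply/esym/freeP; split=> [d|u _]; last by rewrite sink.
rewrite /x /sink_D nd /= in_setU1 => /orP[/eqP->|dy]; first by rewrite sink.
by apply: contraFN nd => dg; apply/exists_inP; exists d.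
Qed.

Lemma toggled_exists x : greedy e x -> exists2 x', greedy e' x' & toggled x x'.
Proof.
move=> gx; have [gx2|gx2] := boolP (g \in x.2).
  by have [? ?] := toggled_move_up gx gx2; eexists; eassumption.
by have [? ?] := toggled_complete_U gx gx2; eexists; eassumption.
Qed.

Lemma toggled_exists_inv y : greedy e' y -> exists2 x, greedy e x & toggled x y.
Proof.
move=> gy; have [gy1|gy1] := boolP (g \in y.1).
  by have [? ?] := toggled_move_down gy gy1; eexists; eassumption.
by have [? ?] := toggled_complete_D gy gy1; eexists; eassumption.
Qed.

(** A path between vertices other than g passes through g neither in e, where g
    is a sink, nor in e', where g is a source. *)
Lemma connect_toggle h k : h != g -> k != g -> connect e' h k = connect e h k.
Proof.
move=> hg kg; apply/idP/idP => /connectP[p].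
  elim: p h hg => [|j p IH] h hg /=; first by move=> _ ->.
  case/andP=> hj pj Ek; have jg : j != g.
    by apply: contraTneq hj => ->; rewrite source.
  by apply: connect_trans (IH _ jg pj Ek); rewrite connect1 // -same.
elim: p h hg => [|j p IH] h hg /=; first by move=> _ ->.
case/andP=> hj pj Ek; have jg : j != g.
  apply/eqP => Ej; subst j; have : connect e g k by apply/connectP; exists p.
  by rewrite connect_sink (negbTE kg).
by apply: connect_trans (IH _ jg pj Ek); rewrite connect1 // same.
Qed.

(** The condition of a step at g itself follows from the one at the other
    vertices: only elements of D with an edge to g decide whether g is in D,
    and these are not below h unless g is. *)
Lemma sink_agree h x y :
  greedy e x -> greedy e y -> (g \in x.2) = (g \in y.2) ->
  (forall k, k != g -> connect e h k = false -> (k \in y.1) = (k \in x.1)) ->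
  connect e h g = false -> (g \in y.1) = (g \in x.1).
Proof.
move=> gx gy gE D hg; rewrite (greedy_memD _ gx) (greedy_memD _ gy) gE.
congr (_ && _); rewrite /free; congr (_ && _); last first.
  by apply/forall_inP/forall_inP => _ u _; rewrite sink.
apply: eq_forallb => d; case dg: (e d g); rewrite ?implybT // D //.
  by apply: contraTneq dg => ->; rewrite sink.
exact: below_edge dg hg.
Qed.

Lemma source_agree h x y :
  greedy e' x -> greedy e' y -> (g \in x.1) = (g \in y.1) ->
  (forall k, k != g -> connect e' k h = false -> (k \in y.2) = (k \in x.2)) ->
  connect e' g h = false -> (g \in y.2) = (g \in x.2).
Proof.
move=> gx gy gE U hg; rewrite (greedy_memU _ gx) (greedy_memU _ gy) gE.
congr (_ && _); rewrite /free; congr (_ && _).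
  by apply/forall_inP/forall_inP => _ u _; rewrite source.
apply: eq_forallb => u; case gu: (e' g u); rewrite ?implybT // U //.
  by apply: contraTneq gu => ->; rewrite source.
exact: above_edge gu hg.
Qed.

(** A step at g would change whether g is in U, so h differs from g. *)
Lemma step_toggled h x y x' y' :
  greedy e' x' -> greedy e' y' -> toggled x x' -> toggled y y' ->
  (g \in x.2) = (g \in y.2) -> step e h x y -> step e' h x' y'.
Proof.
move=> gx' gy' [ax tx] [ay ty] gE [gx gy /andP[hx hy] D U].
have hg : h != g.
  apply: contraTneq hy => Eh; subst h.
  by rewrite (greedy_memD _ gy) -gE hx.
have U' k : k != g -> connect e' k h = false -> (k \in y'.2) = (k \in x'.2).
  by move=> kg; rewrite connect_toggle // => /U; rewrite (ax k kg).2 (ay k kg).2.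
split=> //; first by rewrite (ax h hg).2 (ay h hg).1 hx.
- move=> k; have [->|kg] := eqVneq k g; first by rewrite -tx -ty gE.
  by rewrite connect_toggle // => /D; rewrite (ax k kg).1 (ay k kg).1.
- move=> k; have [->|] := eqVneq k g; last exact: U'.
  by apply: source_agree => //; rewrite -tx -ty.
Qed.

Lemma step_toggled_inv h x y x' y' :
  greedy e x -> greedy e y -> toggled x x' -> toggled y y' ->
  (g \in x.2) = (g \in y.2) -> step e' h x' y' -> step e h x y.
Proof.
move=> gx gy [ax tx] [ay ty] gE [gx' gy' /andP[hx hy] D U].
have hg : h != g.
  apply: contraTneq hx => Eh; subst h.
  by rewrite (greedy_memU _ gx') -tx gE ty hy.
have D' k : k != g -> connect e h k = false -> (k \in y.1) = (k \in x.1).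
  by move=> kg; rewrite -connect_toggle // => /D; rewrite (ax k kg).1 (ay k kg).1.
split=> //; first by rewrite -(ax h hg).2 -(ay h hg).1 hx.
- move=> k; have [->|] := eqVneq k g; last exact: D'.
  exact: sink_agree.
- move=> k; have [->|kg] := eqVneq k g; first by rewrite gE.
  by rewrite -connect_toggle // => /U; rewrite (ax k kg).2 (ay k kg).2.
Qed.

(** Since g can only leave U along a chain of flips, it stays where it is if the
    two ends agree, and each flip of the chain can be transported. *)
Lemma le_toggled x y x' y' :
  greedy e x -> greedy e' x' -> greedy e' y' -> toggled x x' -> toggled y y' ->
  (g \in x.2) = (g \in y.2) -> top_le e l r x y -> top_le e' l' r' x' y'.
Proof.
move=> gx gx' gy' tx ty gE le; move: x y gx le x' y' gx' gy' tx ty gE.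
apply: (top_le_ind El Er) => [x gx x' y' gx' gy' tx ty _|].
  by rewrite (toggled_fun gx' gy' tx ty); exact: connect0.
move=> h x z y st zy IH x' y' gx' gy' tx ty gE.
have [gx gz _ _ _] := st; have [z' gz' tz] := toggled_exists gz.
have zE : (g \in x.2) = (g \in z.2).
  apply/idP/idP => [|/(step_sink_down st) //]; rewrite gE => gy2.
  apply/negPn/negP => gz2.
  suff /step_closed_le/(_ _ _ gz zy gz2)/negP : forall h a b,
    step e h a b -> g \notin a.2 -> g \notin b.2 by apply.
  by move=> i a b /step_sink_down ab; apply: contra.
apply: connect_trans (IH _ _ gz' gy' tz ty _); last by rewrite -zE.
exact/(step_le El' Er')/(step_toggled gx' gz' tx tz zE st).
Qed.

Lemma le_toggled_inv x y x' y' :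
  greedy e x -> greedy e y -> greedy e' x' -> toggled x x' -> toggled y y' ->
  (g \in x.2) = (g \in y.2) -> top_le e' l' r' x' y' -> top_le e l r x y.
Proof.
move=> gx gy gx' tx ty gE le; move: x' y' gx' le x y gx gy tx ty gE.
apply: (top_le_ind El' Er') => [x' gx' x y gx gy tx ty _|].
  by rewrite (toggled_inj gx gy tx ty); exact: connect0.
move=> h x' z' y' st zy IH x y gx gy tx ty gE.
have [gx' gz' _ _ _] := st; have [z gz tz] := toggled_exists_inv gz'.
have zE : (g \in x.2) = (g \in z.2).
  rewrite tx.2 tz.2; apply/idP/idP => [/(step_source_up st) //|gz1].
  rewrite -tx.2 gE ty.2.
  apply: (step_closed_le El' Er' (P := fun x => g \in x.1) _ gz' zy) => //.
  by move=> ? ? ?; apply: step_source_up.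
apply: connect_trans (IH _ _ gz gy tz ty _); last by rewrite -zE.
exact/(step_le El Er)/(step_toggled_inv gx gz tx tz zE st).
Qed.

Section Isomorphism.

Variable b : bool.
Let A := [set x | greedy e x && ((g \in x.2) == b)].
Let B := [set y | greedy e' y && ((g \in y.1) == b)].

Lemma toggle_iso f : (forall x, x \in A -> greedy e' (f x) /\ toggled x (f x)) ->
  poset_iso A (top_le e l r) B (top_le e' l' r') f.
Proof.
move=> Hf; have gA x : x \in A -> greedy e x by rewrite inE => /andP[].
split=> [x y xA yA Exy| |x y xA yA].
- have [_ tx] := Hf x xA; have [_ ty] := Hf y yA.
  by apply: (toggled_inj (gA _ xA) (gA _ yA) tx); rewrite Exy.
- apply/setP => y; apply/imsetP/idP => [[x xA ->]|].
    have [gfx tx] := Hf x xA; rewrite inE gfx -tx.2.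
    by move: xA; rewrite inE => /andP[].
  rewrite inE => /andP[gy yb]; have [x gx tx] := toggled_exists_inv gy.
  have xA : x \in A by rewrite inE gx tx.2.
  by exists x => //; have [gfx tfx] := Hf x xA; apply: toggled_fun tx tfx.
have [gfx tx] := Hf x xA; have [gfy ty] := Hf y yA.
have gE : (g \in x.2) = (g \in y.2).
  by move: xA yA; rewrite !inE => /andP[_ /eqP->] /andP[_ /eqP->].
apply/idP/idP; first exact: le_toggled_inv (gA _ xA) (gA _ yA) gfx tx ty gE.
exact: le_toggled (gA _ xA) gfx gfy tx ty gE.
Qed.

Lemma toggle_iso_inv f :
  (forall y, y \in B -> greedy e (f y) /\ toggled (f y) y) ->
  poset_iso B (top_le e' l' r') A (top_le e l r) f.
Proof.
move=> Hf; have gB x : x \in B -> greedy e' x by rewrite inE => /andP[].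
split=> [x y xB yB Exy| |x y xB yB].
- have [_ tx] := Hf x xB; have [_ ty] := Hf y yB.
  by apply: (toggled_fun (gB _ xB) (gB _ yB) tx); rewrite Exy.
- apply/setP => x; apply/imsetP/idP => [[y yB ->]|].
    have [gfy ty] := Hf y yB; rewrite inE gfy ty.2.
    by move: yB; rewrite inE => /andP[].
  rewrite inE => /andP[gx xb]; have [y gy ty] := toggled_exists gx.
  have yB : y \in B by rewrite inE gy -ty.2.
  by exists y => //; have [gfy tfy] := Hf y yB; apply: toggled_inj ty tfy.
have [gfx tx] := Hf x xB; have [gfy ty] := Hf y yB.
have gE : (g \in (f x).2) = (g \in (f y).2).
  by rewrite tx.2 ty.2; move: xB yB;
    rewrite !inE => /andP[_ /eqP->] /andP[_ /eqP->].
apply/idP/idP; first exact: le_toggled gfx (gB _ xB) (gB _ yB) tx ty gE.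
exact: le_toggled_inv gfx gfy (gB _ xB) tx ty gE.
Qed.

End Isomorphism.

Lemma sink_toggle_poset_iso :
  poset_iso (top_below e l r g) (top_le e l r)
            (top_above e' l' r' g) (top_le e' l' r')
            (fun x => (g |: x.1, x.2 :\ g))
  /\
  exists U' : {set V} * {set V} -> {set V},
    (forall x, x \in top_above e l r g ->
       unique (fun W : {set V} => (x.1 :\ g, W) \in top_below e' l' r' g) (U' x))
    /\ poset_iso (top_above e l r g) (top_le e l r)
                 (top_below e' l' r' g) (top_le e' l' r')
                 (fun x => (x.1 :\ g, U' x)).
Proof.
rewrite sink_below sink_above source_above source_below; split.
  by apply: toggle_iso => x; rewrite inE eqb_id => /andP[];
    apply: toggled_move_up.
exists source_U; split=> [x|].
  rewrite inE eqbF_neg => /andP[gx gx2].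
  have [gx' tx'] := toggled_complete_U gx gx2.
  split=> [|W]; first by rewrite inE gx' -tx'.2 (negbTE gx2).
  rewrite inE => /andP[gW _].
  by have [] := greedy_eqD El' gx' gW erefl.
by apply: toggle_iso => x; rewrite inE eqbF_neg => /andP[];
  apply: toggled_complete_U.
Qed.

Lemma source_toggle_poset_iso :
  (exists D' : {set V} * {set V} -> {set V},
    (forall x, x \in top_below e' l' r' g ->
       unique (fun W : {set V} => (W, x.2 :\ g) \in top_above e l r g) (D' x))
    /\ poset_iso (top_below e' l' r' g) (top_le e' l' r')
                 (top_above e l r g) (top_le e l r)
                 (fun x => (D' x, x.2 :\ g)))
  /\
  poset_iso (top_above e' l' r' g) (top_le e' l' r')
            (top_below e l r g) (top_le e l r)
            (fun x => (x.1 :\ g, g |: x.2)).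
Proof.
rewrite sink_below sink_above source_above source_below; split; last first.
  by apply: toggle_iso_inv => x; rewrite inE eqb_id => /andP[];
    apply: toggled_move_down.
exists sink_D; split=> [x|].
  rewrite inE eqbF_neg => /andP[gx gx1].
  have [gx' tx'] := toggled_complete_D gx gx1.
  split=> [|W]; first by rewrite inE gx' tx'.2 (negbTE gx1).
  rewrite inE => /andP[gW _].
  by have [] := greedy_eqU Er gx' gW erefl.
by apply: toggle_iso_inv => x; rewrite inE eqbF_neg => /andP[];
  apply: toggled_complete_D.
Qed.

End Toggle.

(** * The toggle isomorphisms *)

(* l, r and l', r' are the (arbitrary) linear and reverse linear extensions
   used to compute flips in G and in tog_g(G). *)
Theorem theorem5p1 (V : finType) (e : rel V) (g : V) (l r l' r' : seq V) :
  acyclic e ->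
  linear_extension e l -> reverse_linear_extension e r ->
  linear_extension (tog g e) l' -> reverse_linear_extension (tog g e) r' ->
  (minimal_vertex e g ->
     poset_iso (top_below e l r g) (top_le e l r)
               (top_above (tog g e) l' r' g) (top_le (tog g e) l' r')
               (fun x => (g |: x.1, x.2 :\ g))
     /\
     exists U' : {set V} * {set V} -> {set V},
       (forall x, x \in top_above e l r g ->
          unique (fun W : {set V} =>
                    (x.1 :\ g, W) \in top_below (tog g e) l' r' g) (U' x))
       /\ poset_iso (top_above e l r g) (top_le e l r)
                    (top_below (tog g e) l' r' g) (top_le (tog g e) l' r')
                    (fun x => (x.1 :\ g, U' x)))
  /\
  (maximal_vertex e g ->
     (exists D' : {set V} * {set V} -> {set V},
       (forall x, x \in top_below e l r g ->
          unique (fun W : {set V} =>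
                    (W, x.2 :\ g) \in top_above (tog g e) l' r' g) (D' x))
       /\ poset_iso (top_below e l r g) (top_le e l r)
                    (top_above (tog g e) l' r' g) (top_le (tog g e) l' r')
                    (fun x => (D' x, x.2 :\ g)))
     /\
     poset_iso (top_above e l r g) (top_le e l r)
               (top_below (tog g e) l' r' g) (top_le (tog g e) l' r')
               (fun x => (x.1 :\ g, g |: x.2))).
Proof.
move=> _ El Er El' Er'.
have togL k : tog g e g k = e k g by rewrite /tog eqxx.
have togR k : tog g e k g = e g k by rewrite /tog eqxx orbT.
have togN h k : h != g -> k != g -> tog g e h k = e h k.
  by rewrite /tog => /negbTE-> /negbTE->.
have irr := edge_irr Er.
split=> [gmin|gmax].
  have sink k : e g k = false.
    by apply/negP => gk; move: (gk); rewrite (gmin k (connect1 gk)) irr.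
  by apply: sink_toggle_poset_iso => // k; rewrite togR.
have source k : e k g = false.
  by apply/negP => kg; move: (kg); rewrite (gmax k (connect1 kg)) irr.
by apply: source_toggle_poset_iso => // [k|h k hg kg]; rewrite ?togL ?togR ?togN.
Qed.
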